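(* Let $\mathcal{G}=(A,B,\mathbf{r},\mathbf{j},r_{\mathrm{ave}},j_{\mathrm{ave}})$ be a constrained bimatrix game with $A,B\in\mathbb{R}^{m\times n}$. A pair $(\mathbf{x}^*,\mathbf{y}^* )\in\mathbb{R}^m\times\mathbb{R}^n$ is a Nash equilibrium of $\mathcal{G}$ if and only if there exist scalars $u,v\ge 0$ and $\alpha,\beta\in\mathbb{R}$ such that all of the following conditions hold (vector inequalities are componentwise, $\mathbf{1}$ is the all-ones vector of the appropriate size): Player I: (I.1) $\mathbf{1}^T\mathbf{x}^*-1=0$; (I.2) $\mathbf{r}^T\mathbf{x}^*-r_{\mathrm{ave}}\le 0$; (I.3) $-\mathbf{x}^*\le\mathbf{0}$; (I.4) $A\mathbf{y}^*-u\,\mathbf{r}-\alpha\mathbf{1}\le\mathbf{0}$; (I.5) ${\mathbf{x}^*}^TA\,\mathbf{y}^*-u\,r_{\mathrm{ave}}-\alpha=0$; (I.6) $u(\mathbf{r}^T\mathbf{x}^*-r_{\mathrm{ave}})=0$. Player II: (II.1) $\mathbf{1}^T\mathbf{y}^*-1=0$; (II.2) $\mathbf{j}^T\mathbf{y}^*-j_{\mathrm{ave}}\le 0$; (II.3) $-\mathbf{y}^*\le\mathbf{0}$; (II.4) $B^T\mathbf{x}^*-v\,\mathbf{j}-\beta\mathbf{1}\le\mathbf{0}$; (II.5) ${\mathbf{x}^*}^TB\,\mathbf{y}^*-v\,j_{\mathrm{ave}}-\beta=0$; (II.6) $v(\mathbf{j}^T\mathbf{y}^*-j_{\mathrm{a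ve}})=0$.
   Context: A constrained bimatrix game $\mathcal{G}=(A,B,\mathbf{r},\mathbf{j},r_{\mathrm{ave}},j_{\mathrm{ave}})$ consists of payoff matrices $A,B\in\mathbb{R}^{m\times n}$ (for players I and II), vectors $\mathbf{r}=(r_1,\dots,r_m)^T$ with $0\le r_1<\dots<r_m$ and $\mathbf{j}=(j_1,\dots,j_n)^T$ with $0\le j_1<\dots<j_n$, and real numbers $r_{\mathrm{ave}},j_{\mathrm{ave}}$. It is assumed that $r_{\mathrm{ave}}<\max_i r_i$ or $j_{\mathrm{ave}}<\max_k j_k$. The feasible mixed strategies are $$\widehat{\mathbf{X}}=\{\mathbf{x}\in\mathbb{R}^m_+ : \textstyle\sum_i x_i=1,\ \mathbf{r}^T\mathbf{x}\le r_{\mathrm{ave}}\},\qquad \widehat{\mathbf{Y}}=\{\mathbf{y}\in\mathbb{R}^n_+ : \textstyle\sum_k y_k=1,\ \mathbf{j}^T\mathbf{y}\le j_{\mathrm{ave}}\}.$$ A pair $(\mathbf{x}^*,\mathbf{y}^* )$ is a Nash equilibrium (equilibrium pair) of $\mathcal{G}$ if $\mathbf{x}^*\in\widehat{\mathbf{X}}$, $\mathbf{y}^*\in\widehat{\mathbf{Y}}$, $\mathbf{x}^*$ maximizes $\mathbf{x}^TA\,\mathbf{y}^*$ over $\mathbf{x}\in\widehat{\mathbf{X}}$, and $\mathbf{y}^*$ maximizes ${\mathbf{x}^*}^TB\,\mathbf{y}$ over $\mathbf{y}\in\widehat{\mathbf{Y}}$. *)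

(* Defs.v *)
From HB Require Import structures.
From mathcomp Require Import all_boot all_order all_algebra.
From mathcomp Require Import reals.

Set Implicit Arguments.
Unset Strict Implicit.
Unset Printing Implicit Defensive.

Import Order.TTheory GRing.Theory Num.Theory.

Local Open Scope ring_scope.

Definition dotv (R : realType) (k : nat) (a b : 'cV[R]_k) : R :=
  (a^T *m b) 0 0.

Definition bilin (R : realType) (m n : nat) (x : 'cV[R]_m) (A : 'M[R]_(m, n))
    (y : 'cV[R]_n) : R :=
  (x^T *m A *m y) 0 0.

Definition onesv (R : realType) (k : nat) : 'cV[R]_k := const_mx 1.

Definition lev (R : realType) (k : nat) (a b : 'cV[R]_k) : Prop :=
  forall i, a i 0 <= b i 0.

Definition maxv (R : realType) (k : nat) (a : 'cV[R]_k.+1) : R :=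
  \big[Num.max/a ord0 0]_i a i 0.

(* The players have m.+1 and n.+1 pure strategies: both numbers are positive,
   so that the maxima of the two constraint vectors exist. *)
Record constrained_game (R : realType) (m n : nat) := ConstrainedGame {
  payA : 'M[R]_(m.+1, n.+1);
  payB : 'M[R]_(m.+1, n.+1);
  rvec : 'cV[R]_m.+1;
  jvec : 'cV[R]_n.+1;
  rave : R;
  jave : R;
  rvec_ge0 : 0 <= rvec ord0 0;
  rvec_incr : forall i k : 'I_m.+1, (i < k)%N -> rvec i 0 < rvec k 0;
  jvec_ge0 : 0 <= jvec ord0 0;
  jvec_incr : forall i k : 'I_n.+1, (i < k)%N -> jvec i 0 < jvec k 0;
  ave_lt_max : rave < maxv rvec \/ jave < maxv jvec
}.

Definition mixed_feasible (R : realType) (k : nat) (c : 'cV[R]_k) (cave : R)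
    (z : 'cV[R]_k) : Prop :=
  [/\ forall i, 0 <= z i 0, \sum_i z i 0 = 1 & dotv c z <= cave].

Definition feasibleX (R : realType) (m n : nat) (G : constrained_game R m n)
    (x : 'cV[R]_m.+1) : Prop :=
  mixed_feasible (rvec G) (rave G) x.

Definition feasibleY (R : realType) (m n : nat) (G : constrained_game R m n)
    (y : 'cV[R]_n.+1) : Prop :=
  mixed_feasible (jvec G) (jave G) y.

Definition nash_equilibrium (R : realType) (m n : nat)
    (G : constrained_game R m n) (x : 'cV[R]_m.+1) (y : 'cV[R]_n.+1) : Prop :=
  [/\ feasibleX G x,
      feasibleY G y,
      forall x', feasibleX G x' -> bilin x' (payA G) y <= bilin x (payA G) y
    & forall y', feasibleY G y' -> bilin x (payB G) y' <= bilin x (payB G) y].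

(* Main.v *)
(* The two best-response problems are independent linear programs over a simplex
   cut by one half-space.  If z is optimal with value V, put g i = c i - V and
   e i = d i - b; a multiplier is some u >= 0 with g i <= u * e i for all i.
   Testing optimality against feasible vertices and against mixtures of two
   vertices lying on the constraint hyperplane shows that each lower bound
   g k / e k (e k > 0) is at most each upper bound g i / e i (e i < 0), and that
   0 is too; so the largest lower bound works. *)
Require Import Defs.
From HB Require Import structures.
From mathcomp Require Import all_boot all_order all_algebra.
From mathcomp Require Import reals ring lra.

Set Implicit Arguments.
Unset Strict Implicit.
Unset Printing Implicit Defensive.

Import Order.TTheory GRing.Theory Num.Theory.

Local Open Scope ring_scope.

Lemma nonneg_multiplier (R : realFieldType) (I : finType) (g e : I -> R) :
  (forall i, e i <= 0 -> g i <= 0) ->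
  (forall i k, e i < 0 -> 0 < e k -> e k * g i <= e i * g k) ->
  exists2 u, 0 <= u & forall i, g i <= u * e i.
Proof.
move=> g_le0 cross.
(* The default value 0 gives [0 <= u] and settles the case where no [e k] is positive. *)
exists (\big[Num.max/0]_(k | 0 < e k) (g k / e k)); first exact: bigmax_ge_id.
move=> i; case: (ltrgtP (e i) 0) => [ei_lt0|ei_gt0|ei_eq0].
(* The upper bound [g i / e i] has to dominate the default 0, by [g_le0], and every lower bound, by
   [cross]. *)
- rewrite -ler_ndivlMr //; apply: bigmax_le => [|k ek_gt0].
    by rewrite mulr_le0 ?invr_le0 ?g_le0 ?ltW.
  by rewrite ler_ndivlMr // mulrAC ler_pdivlMr // mulrC [g k * _]mulrC cross.
- by rewrite -ler_pdivrMr //; apply: le_bigmax_cond.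
- by rewrite ei_eq0 mulr0 g_le0 // ei_eq0.
Qed.

Lemma dotvE (R : realType) (k : nat) (a b : 'cV[R]_k) :
  dotv a b = \sum_i a i 0 * b i 0.
Proof. by rewrite /dotv mxE; apply: eq_bigr => i _; rewrite mxE. Qed.

Lemma dotvC (R : realType) (k : nat) (a b : 'cV[R]_k) : dotv a b = dotv b a.
Proof. by rewrite !dotvE; apply: eq_bigr => i _; rewrite mulrC. Qed.

Lemma dotv_onesl (R : realType) (k : nat) (a : 'cV[R]_k) :
  dotv (onesv R k) a = \sum_i a i 0.
Proof. by rewrite dotvE; apply: eq_bigr => i _; rewrite mxE mul1r. Qed.

Lemma dotv_two_point (R : realType) (k : nat) (a : 'cV[R]_k) (i j : 'I_k)
    (s t : R) :
  dotv a (s *: delta_mx i 0 + t *: delta_mx j 0) = s * a i 0 + t * a j 0.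
Proof. by rewrite /dotv mulmxDr -!scalemxAr -!colE !mxE. Qed.

Lemma mixed_feasible_two_point (R : realType) (k : nat) (d : 'cV[R]_k) (b : R)
    (i j : 'I_k) (s t : R) :
  0 <= s -> 0 <= t -> s + t = 1 -> s * d i 0 + t * d j 0 <= b ->
  mixed_feasible d b (s *: delta_mx i 0 + t *: delta_mx j 0).
Proof.
move=> s_ge0 t_ge0 st1 le_b; split; last by rewrite dotv_two_point.
  by move=> l; rewrite !mxE addr_ge0 // mulr_ge0 // ler0n.
by rewrite -dotv_onesl dotv_two_point !mxE !mulr1.
Qed.

(** Weak duality: average the componentwise bounds with weights [z]; [alpha] survives unchanged
    because the weights sum to 1. *)
Lemma dotv_le_dual (R : realType) (k : nat) (c d z : 'cV[R]_k) (b u alpha : R) :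
  0 <= u -> mixed_feasible d b z ->
  (forall i, c i 0 <= u * d i 0 + alpha) ->
  dotv c z <= u * dotv d z + alpha.
Proof.
move=> u_ge0 [z_ge0 z_sum _] c_le.
rewrite -[alpha]mulr1 -z_sum !dotvE !mulr_sumr -big_split /=.
by apply: ler_sum => i _; rewrite mulrA -mulrDl ler_wpM2r.
Qed.

(** Strong duality with the multiplier of the sum constraint already eliminated as [V - u * b]. *)
Lemma optimal_multiplier (R : realType) (k : nat) (c d : 'cV[R]_k) (b V : R) :
  (forall z, mixed_feasible d b z -> dotv c z <= V) ->
  exists2 u, 0 <= u & forall i, c i 0 - V <= u * (d i 0 - b).
Proof.
move=> V_opt.
have two_point i j s t : 0 <= s -> 0 <= t -> s + t = 1 ->
    s * d i 0 + t * d j 0 <= b -> s * c i 0 + t * c j 0 <= V.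
  move=> s_ge0 t_ge0 st1 le_b.
  by rewrite -dotv_two_point; apply: V_opt; apply: mixed_feasible_two_point.
apply: nonneg_multiplier => [i|i j].
  rewrite !subr_le0 => le_b.
  (* The degenerate mixture is the vertex [i] itself. *)
  have := two_point i i 1 0; rewrite !mul0r !mul1r !addr0; exact.
rewrite subr_lt0 subr_gt0 => di_lt dj_gt.
have D_gt0 : 0 < d j 0 - d i 0 by rewrite subr_gt0 (lt_trans di_lt).
have D_neq0 := lt0r_neq0 D_gt0.
(* These weights place the mixture of vertices [i] and [j] exactly on the hyperplane where the
   constraint is tight. *)
pose s := (d j 0 - b) / (d j 0 - d i 0).
pose t := (b - d i 0) / (d j 0 - d i 0).
have : s * c i 0 + t * c j 0 <= V.
  apply: two_point.
  - by rewrite divr_ge0 ?subr_ge0 ?ltW // -subr_gt0.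
  - by rewrite divr_ge0 ?subr_ge0 ?ltW // -subr_gt0.
  - by rewrite /s /t; field.
  - by suff -> : s * d i 0 + t * d j 0 = b by []; rewrite /s /t; field.
(* Over a common denominator, splitting [d j 0 - d i 0] as [(d j 0 - b) + (b - d i 0)] turns the
   bound by [V] into the cross inequality. *)
have -> : s * c i 0 + t * c j 0 =
    ((d j 0 - b) * c i 0 + (b - d i 0) * c j 0) / (d j 0 - d i 0).
  by rewrite /s /t; field.
by rewrite ler_pdivrMr // => ?; lra.
Qed.

Lemma optimal_iff_kkt (R : realType) (k : nat) (c d z : 'cV[R]_k) (b : R) :
  mixed_feasible d b z /\
    (forall z', mixed_feasible d b z' -> dotv c z' <= dotv c z) <->
  exists u alpha : R, 0 <= u /\
    (dotv (onesv R k) z - 1 = 0 /\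
     dotv d z - b <= 0 /\
     lev (- z) 0 /\
     lev (c - u *: d - alpha *: onesv R k) 0 /\
     dotv c z - u * b - alpha = 0 /\
     u * (dotv d z - b) = 0).
Proof.
have levP u alpha : lev (c - u *: d - alpha *: onesv R k) 0 <->
    (forall i, c i 0 <= u * d i 0 + alpha).
  by split=> h i; have := h i; rewrite !mxE => ?; lra.
split=> [[z_feas z_opt]|[u [alpha [u_ge0 [z1 [dz [z_ge0 [/levP h [V_eq slack]]]]]]]]].
- have [u u_ge0 u_mul] := optimal_multiplier z_opt.
  (* The value of [alpha] is dictated by the equation for the optimal value. *)
  have c_le i : c i 0 <= u * d i 0 + (dotv c z - u * b).
    by have := u_mul i; lra.
  have [z_ge0 z_sum z_le] := z_feas.
  exists u, (dotv c z - u * b); split=> //; split; last split; last split;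
    last split; last split.
  + by rewrite dotv_onesl z_sum subrr.
  + by rewrite subr_le0.
  + by move=> i; rewrite !mxE oppr_le0.
  + exact/levP.
  + by ring.
  (* Complementary slackness: feasibility gives [<= 0], and weak duality at [z] itself gives
     [>= 0]. *)
  + apply/eqP; rewrite eq_le mulr_ge0_le0 ?subr_le0 //=.
    by have := dotv_le_dual u_ge0 z_feas c_le; lra.
- split.
    split; last by rewrite -subr_le0.
      by move=> i; have := z_ge0 i; rewrite !mxE oppr_le0.
    by apply/eqP; rewrite -subr_eq0 -dotv_onesl z1.
  move=> z' z'_feas; have [_ _ dz'] := z'_feas.
  (* The chain is [dotv c z' <= u * dotv d z' + alpha <= u * b + alpha = dotv c z]. *)
  have := dotv_le_dual u_ge0 z'_feas h.
  by have := ler_wpM2l u_ge0 dz'; lra.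
Qed.

Lemma bilin_dotvl (R : realType) (m n : nat) (x : 'cV[R]_m) (A : 'M[R]_(m, n))
    (y : 'cV[R]_n) :
  bilin x A y = dotv (A *m y) x.
Proof. by rewrite dotvC /bilin /dotv mulmxA. Qed.

Lemma bilin_dotvr (R : realType) (m n : nat) (x : 'cV[R]_m) (A : 'M[R]_(m, n))
    (y : 'cV[R]_n) :
  bilin x A y = dotv (A^T *m x) y.
Proof. by rewrite /bilin /dotv trmx_mul trmxK. Qed.

Theorem theorem2 (R : realType) (m n : nat) (G : constrained_game R m n)
    (x : 'cV[R]_m.+1) (y : 'cV[R]_n.+1) :
  nash_equilibrium G x y <->
  exists u v alpha beta : R,
    (0 <= u /\ 0 <= v) /\
    (dotv (onesv R m.+1) x - 1 = 0 /\
     dotv (rvec G) x - rave G <= 0 /\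
     lev (- x) 0 /\
     lev (payA G *m y - u *: rvec G - alpha *: onesv R m.+1) 0 /\
     bilin x (payA G) y - u * rave G - alpha = 0 /\
     u * (dotv (rvec G) x - rave G) = 0) /\
    (dotv (onesv R n.+1) y - 1 = 0 /\
     dotv (jvec G) y - jave G <= 0 /\
     lev (- y) 0 /\
     lev ((payB G)^T *m x - v *: jvec G - beta *: onesv R n.+1) 0 /\
     bilin x (payB G) y - v * jave G - beta = 0 /\
     v * (dotv (jvec G) y - jave G) = 0).
Proof.
(* Once the opponent's strategy is fixed, each payoff is linear, with cost vector [payA G *m y] or
   [(payB G)^T *m x]. *)
have kktI := optimal_iff_kkt (payA G *m y) (rvec G) x (rave G).
have kktII := optimal_iff_kkt ((payB G)^T *m x) (jvec G) y (jave G).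
rewrite bilin_dotvl bilin_dotvr.
split=> [[x_feas y_feas x_opt y_opt]|].
- have [|u [alpha [u_ge0 condI]]] := kktI.1.
    by split=> // x' /x_opt; rewrite !bilin_dotvl.
  have [|v [beta [v_ge0 condII]]] := kktII.1.
    by split=> // y' /y_opt; rewrite !bilin_dotvr.
  by exists u, v, alpha, beta.
- move=> [u [v [alpha [beta [[u_ge0 v_ge0] [condI condII]]]]]].
  have [|x_feas x_opt] := kktI.2; first by exists u, alpha.
  have [|y_feas y_opt] := kktII.2; first by exists v, beta.
  split=> // [x' /x_opt|y' /y_opt]; first by rewrite !bilin_dotvl.
  by rewrite !bilin_dotvr.
Qed.
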